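(* Let $A\in\mathbb{R}^{m\times n}$ have columns $a_{.1},\dots,a_{.n}$, let $b\in\mathbb{R}^m$, $c\in\mathbb{R}^n$, and let $\hat{x}\in\mathbb{R}^n$ be a mixed integer feasible solution, i.e. $A\hat{x}=b$, $\hat{x}\ge 0$, and $\hat{x}_j\in\mathbb{Z}$ for $j=q+1,\dots,n$. Let $\mathcal{I}=\{i\in\{1,\dots,n\}:\hat{x}_i>0\}$ and $\bar{\mathcal{I}}=\{i\in\{1,\dots,n\}:\hat{x}_i=0\}$. Suppose $\delta^*\in\mathbb{R}^n$, $y^*\in\mathbb{R}^m$, $s^*=(s^*_i)_{i\in\bar{\mathcal{I}}}$ and $\varepsilon^*=(\varepsilon^*_i)_{i\in\mathcal{I}}$ satisfy $$\begin{aligned} & a_{.i}^\top y^*+\frac{\varepsilon^*_i}{\hat{x}_i}=c_i,\quad \varepsilon^*_i\ge 0, && i\in\mathcal{I},\\ & a_{.i}^\top y^*+s^*_i=c_i,\quad s^*_i\ge 0, && i\in\bar{\mathcal{I}},\\ & A\delta^*=0, &&\\ & \delta^*_i\le \hat{x}_i, && i=1,\dots,n,\\ & \delta^*_i s^*_i=0, && i\in\bar{\mathcal{I}},\\ & \varepsilon^*_i(\hat{x}_i-\delta^*_i)=0, && i\in\mathcal{I}. \end{aligned}$$ Let $x^{LP}=\hat{x}-\delta^*$. Then $$c^\top\hat{x}-c^\top x^{LP}=e^\top\varepsilon^*=\sum_{i\in\mathcal{I}}\varepsilon^*_i .$$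
   Context: Here $q\in\{0,\dots,n\}$ is fixed; the forward mixed integer problem is $\min\{c^\top x: Ax=b,\ x\ge 0,\ x_j \text{ integer for } j=q+1,\dots,n\}$. Its linear programming relaxation $\min\{c^\top x:Ax=b,\ x\ge 0\}$ is assumed feasible with a finite optimal solution. The vector $x^{LP}=\hat{x}-\delta^*$ is the optimal solution of this relaxation associated with the solution $(\delta^*,y^*,s^*,\varepsilon^* )$ of the system. $e$ denotes the all-ones vector. *)

(* Defs.v *)
From HB Require Import structures.
From mathcomp Require Import all_boot all_order all_algebra.
From mathcomp Require Import reals.

Set Implicit Arguments.
Unset Strict Implicit.
Unset Printing Implicit Defensive.

Import Order.TTheory GRing.Theory Num.Theory.
Local Open Scope ring_scope.

Definition dot (R : realType) (k : nat) (u v : 'cV[R]_k) : R :=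
  (u^T *m v) 0 0.

Definition lp_feasible (R : realType) (m n : nat) (A : 'M[R]_(m, n))
    (b : 'cV[R]_m) (x : 'cV[R]_n) : Prop :=
  A *m x = b /\ forall j : 'I_n, 0 <= x j 0.

Definition lp_optimal (R : realType) (m n : nat) (A : 'M[R]_(m, n))
    (b : 'cV[R]_m) (c : 'cV[R]_n) (x : 'cV[R]_n) : Prop :=
  lp_feasible A b x /\
  forall z : 'cV[R]_n, lp_feasible A b z -> dot c x <= dot c z.

(* Indices start at 0: the first [q] variables, [j < q], are continuous and
   the variables [q <= j < n] are integer. *)
Definition mip_feasible (R : realType) (m n q : nat) (A : 'M[R]_(m, n))
    (b : 'cV[R]_m) (x : 'cV[R]_n) : Prop :=
  lp_feasible A b x /\
  forall j : 'I_n, (q <= j)%N -> x j 0 \is a Num.int.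

Definition pos_idx (R : realType) (n : nat) (x : 'cV[R]_n) : {set 'I_n} :=
  [set i | 0 < x i 0].

Definition zero_idx (R : realType) (n : nat) (x : 'cV[R]_n) : {set 'I_n} :=
  [set i | x i 0 == 0].

(* A vector indexed by a set [I : {set 'I_n}] is a column vector of size
   [#|I|]; its [k]-th entry is the component at the index [enum_val k \in I],
   [enum_val] being a bijection from ['I_#|I|] onto [I]. *)
Definition kkt_solution (R : realType) (m n : nat) (A : 'M[R]_(m, n))
    (c xhat delta : 'cV[R]_n) (y : 'cV[R]_m)
    (s : 'cV[R]_#|zero_idx xhat|) (eps : 'cV[R]_#|pos_idx xhat|) : Prop :=
  [/\ forall k : 'I_#|pos_idx xhat|,
        let i := enum_val k in
        dot (col i A) y + eps k 0 / xhat i 0 = c i 0 /\ 0 <= eps k 0,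
      forall k : 'I_#|zero_idx xhat|,
        let i := enum_val k in
        dot (col i A) y + s k 0 = c i 0 /\ 0 <= s k 0,
      A *m delta = 0,
      forall i : 'I_n, delta i 0 <= xhat i 0
    & (forall k : 'I_#|zero_idx xhat|, delta (enum_val k) 0 * s k 0 = 0) /\
      (forall k : 'I_#|pos_idx xhat|,
        let i := enum_val k in eps k 0 * (xhat i 0 - delta i 0) = 0)].

(* Main.v *)
Require Import Defs.
From HB Require Import structures.
From mathcomp Require Import all_boot all_order all_algebra.
From mathcomp Require Import reals.

Set Implicit Arguments.
Unset Strict Implicit.
Unset Printing Implicit Defensive.

Import Order.TTheory GRing.Theory Num.Theory.
Local Open Scope ring_scope.

(** The gap between the two objective values is [dot c delta].  Since [delta]
    lies in the kernel of [A], pricing it with the reduced costs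
    [c i 0 - dot (col i A) y] instead of [c] does not change its cost
    ([dot_ker_reduced_cost]).  The entries of [xhat] are nonnegative, so the
    cost splits over the support of [xhat] and its zero set
    ([sum_pos_zero_idx]).  On the zero set the reduced cost is [s], and
    complementarity with [delta] kills every term.  On the support the reduced
    cost is [eps / xhat], and complementarity gives
    [delta * eps = xhat * eps], so that each term is exactly the component of
    [eps]. *)

Lemma dotE (R : realType) (k : nat) (u v : 'cV[R]_k) :
  dot u v = \sum_i u i 0 * v i 0.
Proof. by rewrite /dot mxE; apply: eq_bigr => i _; rewrite mxE. Qed.

Lemma dot_const1 (R : realType) (k : nat) (u : 'cV[R]_k) :
  dot (const_mx 1) u = \sum_i u i 0.
Proof. by rewrite dotE; apply: eq_bigr => i _; rewrite mxE mul1r. Qed.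

Lemma dotBr (R : realType) (k : nat) (u v w : 'cV[R]_k) :
  dot u (v - w) = dot u v - dot u w.
Proof. by rewrite /dot mulmxBr !mxE. Qed.

(** Subtracting [A^T *m y] from the cost changes the cost of [d] by
    [dot (A *m d) y], which vanishes on the kernel of [A]. *)
Lemma dot_ker_reduced_cost (R : realType) (m n : nat) (A : 'M[R]_(m, n))
    (c d : 'cV[R]_n) (y : 'cV[R]_m) :
  A *m d = 0 ->
  dot c d = \sum_i (c i 0 - dot (col i A) y) * d i 0.
Proof.
move=> Ad0; under eq_bigr do rewrite mulrBl.
rewrite sumrB -dotE [X in _ - X](_ : _ = 0) ?subr0 //.
have -> : \sum_i dot (col i A) y * d i 0 = (y^T *m (A *m d)) 0 0.
  rewrite mulmxA mxE; apply: eq_bigr => i _; congr (_ * _).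
  rewrite dotE mxE; apply: eq_bigr => j _.
  by rewrite !mxE mulrC.
by rewrite Ad0 mulmx0 mxE.
Qed.

Lemma sum_pos_zero_idx (R : realType) (n : nat) (x : 'cV[R]_n)
    (F : 'I_n -> R) :
  (forall i, 0 <= x i 0) ->
  \sum_i F i = \sum_(k < #|pos_idx x|) F (enum_val k) +
               \sum_(k < #|zero_idx x|) F (enum_val k).
Proof.
move=> x_ge0; rewrite (bigID (mem (pos_idx x))) /=.
congr (_ + _); rewrite -[RHS]big_enum_val //; apply: eq_bigl => i.
by rewrite !inE lt0r x_ge0 andbT negbK.
Qed.

Theorem corollary1 (R : realType) (m n q : nat) (hq : (q <= n)%N)
    (A : 'M[R]_(m, n)) (b : 'cV[R]_m) (c : 'cV[R]_n)
    (hLP : exists x : 'cV[R]_n, lp_optimal A b c x)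
    (xhat : 'cV[R]_n) (hxhat : mip_feasible q A b xhat)
    (delta : 'cV[R]_n) (y : 'cV[R]_m)
    (s : 'cV[R]_#|zero_idx xhat|) (eps : 'cV[R]_#|pos_idx xhat|)
    (hsys : kkt_solution A c delta y s eps) :
  let xLP := xhat - delta in
  dot c xhat - dot c xLP = dot (const_mx 1) eps /\
  dot (const_mx 1) eps = \sum_(k < #|pos_idx xhat|) eps k 0.
Proof.
move=> xLP; split; last exact: dot_const1.
case: hxhat => -[_ x_ge0] _.
case: hsys => dual_pos dual_zero Adelta0 _ [compl_s compl_eps].
rewrite /xLP dotBr subKr dot_const1 (dot_ker_reduced_cost c y Adelta0).
rewrite (sum_pos_zero_idx _ x_ge0) [X in _ + X]big1 ?addr0; last first.
  by move=> k _; rewrite -(dual_zero k).1 addrC addKr mulrC compl_s.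
apply: eq_bigr => k _; rewrite -(dual_pos k).1 addrC addKr.
have x_neq0 : xhat (enum_val k) 0 != 0.
  by have := enum_valP k; rewrite inE => /lt0r_neq0.
move: (compl_eps k) => /= /eqP; rewrite mulrBr subr_eq0 => /eqP eps_delta.
by rewrite mulrAC -eps_delta mulfK.
Qed.
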